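(* Let $\mathbb{K}=\mathbb{R}$ or $\mathbb{C}$, and let $A=\begin{pmatrix}a&1\\0&a\end{pmatrix}$, $B=\begin{pmatrix}b&0\\0&c\end{pmatrix}$ with $a,b,c\in\mathbb{K}$. Consider the system $XAX=BXB$, $XBX=AXA$ for $X\in M_2(\mathbb{K})$. (a) Suppose $a=0$. (i) If $b,c\neq0$, the system has only the trivial solution. (ii) If $b=0$ and $c\neq0$, the solutions are $X=\begin{pmatrix}\alpha&\beta\\0&0\end{pmatrix}$ with $\alpha,\beta\in\mathbb{K}$. (iii) If $b\neq0$ and $c=0$, the solutions are $X=\begin{pmatrix}0&\alpha\\0&\beta\end{pmatrix}$ with $\alpha,\beta\in\mathbb{K}$. (b) If $a\neq0$ and $b,c\in\mathbb{K}$ are arbitrary, the system has only the trivial solution.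
   Context: The trivial solution is $X=0$. *)

(* Defs.v *)
From mathcomp Require Import all_boot all_order all_algebra.
From mathcomp Require Import reals complex.

Set Implicit Arguments.
Unset Strict Implicit.
Unset Printing Implicit Defensive.

Import GRing.Theory.
Local Open Scope ring_scope.

Inductive scalar_kind := RealScalars | ComplexScalars.

Definition scalars (R : realType) (k : scalar_kind) : fieldType :=
  match k with
  | RealScalars => R : fieldType
  | ComplexScalars => R[i]%C : fieldType
  end.

Definition mx2 (K : fieldType) (x y z w : K) : 'M[K]_2 :=
  \matrix_(i < 2, j < 2)
    (if i == 0 then if j == 0 then x else y
     else if j == 0 then z else w).

Definition is_solution (K : fieldType) (A B X : 'M[K]_2) : Prop :=
  X *m A *m X = B *m X *m B /\ X *m B *m X = A *m X *m A.

(* Main.v *)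
Require Import Defs.
From mathcomp Require Import all_boot all_order all_algebra.
From mathcomp Require Import reals complex.
From mathcomp Require Import ring.

Import GRing.Theory.
Local Open Scope ring_scope.

(** Write X = (x, y; z, w) and compare entries. If a = 0, then X B X = A X A
    contains y (b x + c w) = z and z (b x + c w) = 0, so z^2 = 0, and the rest
    is immediate. If a <> 0, then
    z <> 0 would give b x + c w = a^2 and b c = 0, and each of b = 0, c = 0
    leads back to z = 0. With z = 0, either x = w = 0 and hence y = 0, or both
    x and w are nonzero; in the latter case b^3 = c^3 = a^3 and the remaining
    equations collapse to 3 b^2 c^2 = 0, impossible in characteristic zero. *)

(** A substitute for a linear-combination tactic: each use adds [k] times a known equation to the
    goal. Chained uses give a certificate that [ring] checks. *)
Lemma eq_lincomb {K : fieldType} (k : K) {l r p q : K} :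
  l = r -> p = q + k * (l - r) -> p = q.
Proof. by move=> -> ->; rewrite subrr mulr0 addr0. Qed.

Lemma mx2_eta (K : fieldType) (X : 'M[K]_2) :
  X = mx2 (X 0 0) (X 0 1) (X 1 0) (X 1 1).
Proof.
apply/matrixP => i j; rewrite mxE.
by case: i j => [[|[|//]] i] [[|[|//]] j]; congr (X _ _); apply: val_inj.
Qed.

Lemma mx2_inj (K : fieldType) (x y z w x' y' z' w' : K) :
  mx2 x y z w = mx2 x' y' z' w' <-> [/\ x = x', y = y', z = z' & w = w'].
Proof.
split=> [/matrixP E|[-> -> -> ->]//].
by split; [have := E 0 0|have := E 0 1|have := E 1 0|have := E 1 1]; rewrite !mxE.
Qed.

Lemma mx2_0 (K : fieldType) : mx2 0 0 0 0 = 0 :> 'M[K]_2.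
Proof. by apply/matrixP => i j; rewrite !mxE; do !case: ifP. Qed.

Lemma mulmx2 (K : fieldType) (x y z w x' y' z' w' : K) :
  mx2 x y z w *m mx2 x' y' z' w' =
  mx2 (x * x' + y * z') (x * y' + y * w') (z * x' + w * z') (z * y' + w * w').
Proof.
apply/matrixP => i j; rewrite !mxE !big_ord_recl big_ord0 addr0 !mxE /=.
by do 2!case: ifP.
Qed.

Lemma is_solution_mx2 (K : fieldType) (a b c x y z w : K) :
  is_solution (mx2 a 1 0 a) (mx2 b 0 0 c) (mx2 x y z w) <->
  [/\ a * (x * x + y * z) + x * z = b * b * x,
      a * y * (x + w) + x * w = b * c * y,
      a * z * (x + w) + z * z = b * c * z &
      a * (y * z + w * w) + z * w = c * c * w] /\
  [/\ b * x * x + c * y * z = a * a * x + a * z,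
      y * (b * x + c * w) = a * a * y + a * (x + w) + z,
      z * (b * x + c * w) = a * a * z &
      b * y * z + c * w * w = a * z + a * a * w].
Proof.
rewrite /is_solution !mulmx2 !mx2_inj.
split=> -[[e1 e2 e3 e4] [e5 e6 e7 e8]]; (split; split;
  [move: e1|move: e2|move: e3|move: e4|move: e5|move: e6|move: e7|move: e8];
  by move/(eq_lincomb 1); apply; ring).
Qed.

Section Solutions.
Variable K : fieldType.
Implicit Types a b c x y z w : K.

Lemma is_solution_nilpotent b c x y z w :
  is_solution (mx2 0 1 0 0) (mx2 b 0 0 c) (mx2 x y z w) ->
  [/\ z = 0, b * b * x = 0, c * c * w = 0 & x * w = b * c * y].
Proof.
move=> /is_solution_mx2 [[e1 e2 e3 e4] [e5 e6 e7 e8]].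
have /eqP : z * z = 0 by
  apply: (eq_lincomb (- z) e6); apply: (eq_lincomb y e7); ring.
rewrite mulf_eq0 orbb => /eqP z0; subst z.
split=> //.
- apply: (eq_lincomb (- 1) e1); ring.
- apply: (eq_lincomb (- 1) e4); ring.
- apply: (eq_lincomb 1 e2); ring.
Qed.

Lemma is_solution0 (A B : 'M[K]_2) : is_solution A B 0.
Proof. by rewrite /is_solution !(mulmx0, mul0mx). Qed.

Lemma is_solution_regular_ll a b c x y z w : a != 0 ->
  is_solution (mx2 a 1 0 a) (mx2 b 0 0 c) (mx2 x y z w) -> z = 0.
Proof.
move=> a0 /is_solution_mx2 [[e1 e2 e3 e4] [e5 e6 e7 e8]].
apply/eqP; apply/negPn/negP => z0.
have h : b * x + c * w = a * a by
  apply: (mulfI z0); apply: (eq_lincomb 1 e7); ring.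
have s : a * (x + w) + z = 0 by
  apply: (eq_lincomb (- 1) e6); apply: (eq_lincomb y h); ring.
(* The left side of [e3] is z times that of [s], so [e3] reduces to b c z = 0. *)
have /eqP : b * c = 0 by
  apply: (mulfI z0); apply: (eq_lincomb (- 1) e3); apply: (eq_lincomb z s);
  ring.
(* If b = 0, then c w = a^2 and [e8] reduces to a z = 0; if c = 0, then b x = a^2 and [e5] does the
   same. *)
rewrite mulf_eq0 => /orP[] /eqP ?; subst.
  have /eqP : a * z = 0 by
    apply: (eq_lincomb (- 1) e8); apply: (eq_lincomb w h); ring.
  by rewrite mulf_eq0 (negPf a0) (negPf z0).
have /eqP : a * z = 0 by
  apply: (eq_lincomb (- 1) e5); apply: (eq_lincomb x h); ring.
by rewrite mulf_eq0 (negPf a0) (negPf z0).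
Qed.

(** Characteristic zero enters only through [3%:R != 0], which rules out the case where x and w are
    both nonzero. *)
Lemma is_solution_regular a b c (X : 'M[K]_2) : a != 0 -> 3%:R != 0 :> K ->
  is_solution (mx2 a 1 0 a) (mx2 b 0 0 c) X -> X = 0.
Proof.
move=> a0 three0; rewrite [X]mx2_eta.
move: (X 0 0) (X 0 1) (X 1 0) (X 1 1) => x y z w solX.
have z0 := is_solution_regular_ll _ _ _ _ _ _ _ a0 solX; subst z.
move/is_solution_mx2: solX => [[e1 e2 _ e4] [e5 e6 _ e8]].
have aa0 : a * a != 0 by rewrite mulf_neq0.
have [x0|x0] := eqVneq x 0.
  subst x; have [w0|w0] := eqVneq w 0.
    subst w; have -> : y = 0 by
      apply: (mulfI aa0); apply: (eq_lincomb (- 1) e6); ring.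
    exact: mx2_0.
  (* With x = 0 and c w = a^2, the terms in y cancel in [e6], leaving a w = 0. *)
  have cw : c * w = a * a by apply: (mulIf w0); apply: (eq_lincomb 1 e8); ring.
  case/eqP: w0;
    apply: (mulfI a0); apply: (eq_lincomb (- 1) e6); apply: (eq_lincomb y cw);
    ring.
have bx : b * x = a * a by apply: (mulIf x0); apply: (eq_lincomb 1 e5); ring.
have ax : a * x = b * b by apply: (mulIf x0); apply: (eq_lincomb 1 e1); ring.
have [w0|w0] := eqVneq w 0.
  subst w; case/eqP: x0;
    apply: (mulfI a0); apply: (eq_lincomb (- 1) e6); apply: (eq_lincomb y bx);
    ring.
have cw : c * w = a * a by apply: (mulIf w0); apply: (eq_lincomb 1 e8); ring.
have aw : a * w = c * c by apply: (mulIf w0); apply: (eq_lincomb 1 e4); ring.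
have b0 : b != 0 by apply: contra_neq aa0 => b0; rewrite -bx b0 mul0r.
have c0 : c != 0 by apply: contra_neq aa0 => c0; rewrite -cw c0 mul0r.
have b3 : b * b * b = a * a * a by rewrite -ax -mulrA [x * b]mulrC bx mulrA.
have c3 : c * c * c = a * a * a by rewrite -aw -mulrA [w * c]mulrC cw mulrA.
(* Since b x + c w = 2 a^2, [e6] becomes a^2 y = a x + a w. *)
have aay : a * a * y = b * b + c * c by
  apply: (eq_lincomb 1 e6); apply: (eq_lincomb (- y) bx);
  apply: (eq_lincomb (- y) cw); apply: (eq_lincomb 1 ax);
  apply: (eq_lincomb 1 aw); ring.
(* This is [e2] times a^2: the factor makes x, w and y appear only as a x, a w and a^2 y, all known
   in terms of b and c. *)
have key : (b * b + c * c) * (b * b + c * c) + b * b * (c * c)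
           = b * c * (b * b + c * c).
  have := congr1 ( *%R (a * a)) e2; have -> : a * a * (a * y * (x + w) + x * w) =
    a * a * y * (a * x + a * w) + a * x * (a * w) by ring.
  have -> : a * a * (b * c * y) = b * c * (a * a * y) by ring.
  by rewrite ax aw aay.
have /eqP : 3%:R * (b * b * (c * c)) = 0.
  (* Expanded, [d] reads b^4 + c^4 = b^3 c + b c^3; subtracting it from [key] leaves exactly 3 b^2
     c^2 = 0. *)
  have d : (b * b * b - c * c * c) * (b - c) = 0 by rewrite b3 c3 subrr mul0r.
  apply: (eq_lincomb 1 key); apply: (eq_lincomb (- 1) d); ring.
by rewrite !mulf_eq0 (negPf three0) (negPf b0) (negPf c0).
Qed.

End Solutions.

Lemma scalars_natr_neq0 (R : realType) (k : scalar_kind) n :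
  n.+1%:R != 0 :> scalars R k.
Proof. by case: k; rewrite Num.Theory.pnatr_eq0. Qed.

Theorem proposition6p4 (R : realType) (k : scalar_kind) (a b c : scalars R k) :
  let A := mx2 a 1 0 a in
  let B := mx2 b 0 0 c in
  (a = 0 ->
     (b <> 0 -> c <> 0 ->
        forall X : 'M[scalars R k]_2, is_solution A B X <-> X = 0) /\
     (b = 0 -> c <> 0 ->
        forall X : 'M[scalars R k]_2, is_solution A B X <->
          exists alpha beta : scalars R k, X = mx2 alpha beta 0 0) /\
     (b <> 0 -> c = 0 ->
        forall X : 'M[scalars R k]_2, is_solution A B X <->
          exists alpha beta : scalars R k, X = mx2 0 alpha 0 beta)) /\
  (a <> 0 ->
     forall X : 'M[scalars R k]_2, is_solution A B X <-> X = 0).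
Proof.
move=> A B; rewrite {}/A {}/B; have sqr0 (d x : scalars R k) :
  d <> 0 -> d * d * x = 0 -> x = 0.
  by move=> /eqP d0 /eqP; rewrite !mulf_eq0 (negPf d0) => /eqP.
split=> [a0|/eqP a0 X]; last first.
  split=> [|->]; last exact: is_solution0.
  (* The argument 2 yields 3 != 0, as the lemma concerns [n.+1]. *)
  exact: is_solution_regular a0 (scalars_natr_neq0 R k 2).
subst a; split=> [b0 c0 X|]; last split=> [b0 c0 X|b0 c0 X].
- split=> [|->]; last exact: is_solution0.
  rewrite [X]mx2_eta => /is_solution_nilpotent[-> /(sqr0 _ _ b0)-> /(sqr0 _ _ c0)->].
  (* Once x = w = 0, the relation [x * w = b * c * y] forces y = 0. *)
  rewrite mul0r => /esym/eqP; rewrite !mulf_eq0 (introF eqP b0) (introF eqP c0).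
  by move=> /eqP ->; exact: mx2_0.
- subst b; split=> [|[x [y ->]]].
    rewrite [X]mx2_eta => /is_solution_nilpotent[-> _ /(sqr0 _ _ c0)-> _].
    by do 2!eexists.
  by apply/is_solution_mx2; split; split; ring.
- subst c; split=> [|[y [w ->]]].
    rewrite [X]mx2_eta => /is_solution_nilpotent[-> /(sqr0 _ _ b0)-> _ _].
    by do 2!eexists.
  by apply/is_solution_mx2; split; split; ring.
Qed.
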